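(* Let $W$ be a weight and $(P_n)_n$ its sequence of monic matrix valued orthogonal polynomials. (i) Every dual family $(Q_x,M_1,M_2,\rho)$ for $(P_n)_n$ determines a second order difference operator $D\in\mathcal B_R^2(P)$. (ii) Conversely, if $D\in\mathcal B^2_R(P)$ is given by $D=\eta F_1(x)+F_0(x)+\eta^{-1}F_{-1}(x)$, then there exists a unique sequence of dual polynomials $(Q_x)_x$, which are given by $$P_n(x)=P_n(0)\,Q_x(\rho(n))\,\Upsilon(x),\quad \rho(n)=P_n(0)^{-1}\psi^{-1}(D)P_n(0),\quad \Upsilon(x)=F_1(0)^{-1}\cdots F_1(x-1)^{-1},\ \ \Upsilon(0)=I.$$ Moreover, the dual sequence satisfies the three term recurrence relation $$\rho(n)Q_x(\rho(n))=Q_{x+1}(\rho(n))+Q_x(\rho(n))\mathcal Y_x+Q_{x-1}(\rho(n))\mathcal Z_x,\qquad x\in\mathbb N_0,$$ with coefficients $$\mathcal Y_x=\Upsilon(x)F_0(x)\Upsilon(x)^{-1},\qquad \mathcal Z_x=\Upsilon(x-1)F_{-1}(x)\Upsilon(x)^{-1},\qquad x\in\mathbb N,$$ and $\mathcal Y_0=F_0(0)+P_n(0)^{-1}P_n(-1)F_{-1}(0)$, $\mathcal Z_0=0$.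
   Context: $\mathbb N=\{1,2,\dots\}$, $\mathbb N_0=\{0,1,2,\dots\}$; $N\ge1$ is fixed; $I$ is the identity of $M_N(\mathbb C)$. A weight is a function $W:\mathbb Z\to M_N(\mathbb C)$ with $W(x)$ positive definite for $x\in\mathbb N_0$, $W(x)=0$ for $x<0$, and finite moments of all orders. It defines $\langle P,Q\rangle=\sum_{x=0}^\infty P(x)W(x)Q(x)^*$ on matrix polynomials $M_N(\mathbb C)[x]$; $(P_n)_n$ is the unique sequence of monic (leading coefficient $I$) matrix polynomials with $\deg P_n=n$ and $\langle P_m,P_n\rangle=\mathcal H_m\delta_{m,n}$. Difference operators $D=\sum_{j=-\ell}^m\eta^jF_j(x)$, with $F_j$ matrix functions with entries rational in $x$, act from the right: $(P\cdot D)(x)=\sum_jP(x+j)F_j(x)$. $\mathcal B_R(P)$ is the set of such $D$ for which there is a matrix sequence $\Gamma_n$ with $P_n\cdot D=\Gamma_nP_n$ for all $n\in\mathbb N_0$; this sequence is unique and is denoted by $\psi^{-1}(D)$. Condition (V) on $\rho:\mathbb N_0\to M_N(\mathbb C)$: each entry of $\rho(n)$ is a rational function of $n$ without poles in $\mathbb N_0$, and for every $x\in\mathbb N_0$ there exist $k_0,\dots,k_x\in\mathbb N_0$ such that the block Vandermonde matrix with $(i,j)$ block $\rho(k_i)^j$, $0\le i,j\le x$, is invertible. Matrix polynomials in a matrix variable $\mathcal N$ are evaluated with the variable on the left: $Q(\mathcal N)=\sum_k\mathcal N^kA_k$. Dual family: a 4-tuple $(Q_x,M_1,M_2,\rho)$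 where $(Q_x)_{x\in\mathbb N_0}$ are monic matrix polynomials with $\deg Q_x=x$; $\rho$ satisfies Condition (V); there are matrices $\mathcal Y_x,\mathcal Z_x$ with $\rho(n)Q_x(\rho(n))=Q_{x+1}(\rho(n))+Q_x(\rho(n))\mathcal Y_x+Q_{x-1}(\rho(n))\mathcal Z_x$ for all $x,n\in\mathbb N_0$, $Q_0=I$, $Q_{-1}=0$, $\mathcal Z_0=0$; $M_1(n),M_2(x)$ are invertible matrix valued functions on $\mathbb N_0$ with $M_2(x+1)^{-1}M_2(x)$ a rational function of $x$; and $P_n(x)=M_1(n)Q_x(\rho(n))M_2(x)$ for all $x,n\in\mathbb N_0$. Standing normalization: $M_1(0)=M_2(0)=I$. $\mathcal B_R^2(P)$ is the set of all second order difference operators $D=\eta F_1(x)+F_0(x)+\eta^{-1}F_{-1}(x)\in\mathcal B_R(P)$ such that: $P_n(0)^{-1}P_n(-1)F_{-1}(0)$ is independent of $n$; $F_1(x)$ is nonsingular for all $x\in\mathbb N_0$; and there exists an invertible matrix $M_1(n)$ such that $M_1(n)^{-1}\psi^{-1}(D)M_1(n)$ satisfies Condition (V).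
   Formalization: In (ii), the dual polynomials are shown to satisfy every clause of a dual family except that the entries of ρ(n) are rational in n; that half of Condition (V) can fail for D in B_R^2(P), and the full dual family holds whenever ρ is rational. *)

(* Defs.v *)
From HB Require Import structures.
From mathcomp Require Import all_boot all_order all_algebra.
From mathcomp Require Import finmap complex.
From mathcomp Require Import boolp classical_sets reals topology normedtype sequences.

Set Implicit Arguments.
Unset Strict Implicit.
Unset Printing Implicit Defensive.

Import Order.TTheory GRing.Theory Num.Theory.
Import numFieldNormedType.Exports.

Local Open Scope classical_set_scope.
Local Open Scope ring_scope.
Local Open Scope sesquilinear_scope.

(* Size N >= 1 is encoded as N.+1. In a matrix ring, A^-1 is invmx A. *)

(** Weights and orthogonal polynomials *)

Definition posdefmx (C : numClosedFieldType) (N : nat) (A : 'M[C]_N.+1) : Prop :=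
  A \is hermsymmx /\
  forall v : 'rV[C]_N.+1, v != 0 -> 0 < (v *m A *m v^t*) ord0 ord0.

Definition is_weight (C : numClosedFieldType) (N : nat)
    (W : int -> 'M[C]_N.+1) : Prop :=
  [/\ forall x : nat, posdefmx (W x),
      forall x : int, x < 0 -> W x = 0
    & forall k : nat, exists L : 'M[C]_N.+1,
        series (fun x : nat => (x%:R ^+ k) *: W x) @ \oo --> L].

(* [p.[x%:R]] is evaluation at the scalar x: [x%:R] is a scalar matrix. *)
Definition is_inner_product (C : numClosedFieldType) (N : nat)
    (W : int -> 'M[C]_N.+1) (p q : {poly 'M[C]_N.+1}) (L : 'M[C]_N.+1) : Prop :=
  series (fun x : nat => p.[x%:R] * W x * q.[x%:R]^t*) @ \oo --> L.

Definition is_monic_mvop (C : numClosedFieldType) (N : nat)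
    (W : int -> 'M[C]_N.+1) (P : nat -> {poly 'M[C]_N.+1}) : Prop :=
  (forall n, P n \is monic /\ size (P n) = n.+1) /\
  exists H : nat -> 'M[C]_N.+1, forall m n,
    is_inner_product W (P m) (P n) (if m == n then H m else 0).

(** Rational functions *)

Definition ratfun (C : fieldType) := {fraction {poly C}}.

Definition has_value (C : fieldType) (f : ratfun C) (a v : C) : Prop :=
  exists p q : {poly C},
    [/\ q.[a] != 0, f = tofrac p / tofrac q & v = p.[a] / q.[a]].

(* Total evaluation, with value 0 at a pole. *)
Definition evalmx (C : fieldType) (N : nat)
    (F : 'M[ratfun C]_N.+1) (a : C) : 'M[C]_N.+1 :=
  map_mx (fun f : ratfun C => xget 0 [set v | has_value f a v]) F.

Definition rational_seq (C : fieldType) (N : nat) (f : nat -> 'M[C]_N.+1) : Prop :=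
  exists F : 'M[ratfun C]_N.+1,
    forall (n : nat) i j, has_value (F i j) n%:R (f n i j).

(** Difference operators acting from the right *)

(* D stands for the sum over j of eta^j D(j). Coefficients of an operator in
   [in_BR P] are polynomial, so evaluating them with [evalmx] meets no pole. *)
Definition diffop (C : fieldType) (N : nat) :=
  {fsfun int -> 'M[ratfun C]_N.+1 with 0}.

Definition shiftmx (C : fieldType) (N : nat) (j : int)
    (p : {poly 'M[C]_N.+1}) : 'M[ratfun C]_N.+1 :=
  \matrix_(a, b) tofrac ((\poly_(k < size p) p`_k a b) \Po ('X + (j%:~R)%:P)).

Definition act (C : fieldType) (N : nat) (p : {poly 'M[C]_N.+1})
    (D : diffop C N) : 'M[ratfun C]_N.+1 :=
  \sum_(j <- finsupp D) shiftmx j p * D j.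

Definition is_eigen (C : fieldType) (N : nat) (p : {poly 'M[C]_N.+1})
    (D : diffop C N) (G : 'M[C]_N.+1) : Prop :=
  act p D = map_mx (fun c : C => tofrac c%:P) G * shiftmx 0 p.

Definition in_BR (C : fieldType) (N : nat) (P : nat -> {poly 'M[C]_N.+1})
    (D : diffop C N) : Prop :=
  exists G : nat -> 'M[C]_N.+1, forall n, is_eigen (P n) D (G n).

Definition psi_inv (C : fieldType) (N : nat) (P : nat -> {poly 'M[C]_N.+1})
    (D : diffop C N) (n : nat) : 'M[C]_N.+1 :=
  xget 0 [set G | is_eigen (P n) D G].

Definition second_order (C : fieldType) (N : nat) (D : diffop C N) : Prop :=
  forall j : int, j \notin [:: 1; 0; -1] -> D j = 0.

(** Condition (V) *)

Definition block_vandermonde (C : fieldType) (N : nat)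
    (rho : nat -> 'M[C]_N.+1) : Prop :=
  forall x : nat, exists k : 'I_x.+1 -> nat,
    \mxblock_(i < x.+1, j < x.+1) (rho (k i) ^+ j) \in unitmx.

Definition condV (C : fieldType) (N : nat) (rho : nat -> 'M[C]_N.+1) : Prop :=
  rational_seq rho /\ block_vandermonde rho.

Definition in_BR2 (C : fieldType) (N : nat) (P : nat -> {poly 'M[C]_N.+1})
    (D : diffop C N) : Prop :=
  [/\ in_BR P D /\ second_order D,
      exists c : 'M[C]_N.+1, forall n,
        (P n).[0]^-1 * (P n).[-1] * evalmx (D (-1)) 0 = c,
      forall x : nat, evalmx (D 1) x%:R \in unitmx
    & exists M1 : nat -> 'M[C]_N.+1,
        (forall n, M1 n \in unitmx) /\
        condV (fun n => (M1 n)^-1 * psi_inv P D n * M1 n)].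

(** Dual families *)

(* The library's [horner] puts the powers of the variable on the right of the
   coefficients; here they are on the left. *)
Definition lhorner (C : fieldType) (N : nat) (q : {poly 'M[C]_N.+1})
    (A : 'M[C]_N.+1) : 'M[C]_N.+1 :=
  \sum_(k < size q) A ^+ k * q`_k.

Definition three_term (C : fieldType) (N : nat)
    (Q : nat -> {poly 'M[C]_N.+1}) (rho Y Z : nat -> 'M[C]_N.+1) : Prop :=
  forall x n : nat,
    rho n * lhorner (Q x) (rho n) =
      lhorner (Q x.+1) (rho n) + lhorner (Q x) (rho n) * Y x +
      (if x is y.+1 then lhorner (Q y) (rho n) else 0) * Z x.

(* All the clauses defining a dual family other than Condition (V) for rho.
   They are kept apart because, for D in [in_BR2 P], the sequence
   P_n(0)^-1 psi_inv(D)_n P_n(0) always satisfies the Vandermonde half of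
   Condition (V) but its entries need not be rational in n. *)
Definition dual_system (C : fieldType) (N : nat) (P Q : nat -> {poly 'M[C]_N.+1})
    (M1 M2 rho : nat -> 'M[C]_N.+1) : Prop :=
  [/\ (forall x, Q x \is monic /\ size (Q x) = x.+1) /\ Q 0%N = 1,
      exists Y Z : nat -> 'M[C]_N.+1, Z 0%N = 0 /\ three_term Q rho Y Z,
      (forall n, M1 n \in unitmx) /\ (forall x, M2 x \in unitmx),
      rational_seq (fun x => (M2 x.+1)^-1 * M2 x)
    & (forall n x : nat, (P n).[x%:R] = M1 n * lhorner (Q x) (rho n) * M2 x) /\
      (M1 0%N = 1 /\ M2 0%N = 1)].

Definition dual_family (C : fieldType) (N : nat) (P Q : nat -> {poly 'M[C]_N.+1})
    (M1 M2 rho : nat -> 'M[C]_N.+1) : Prop :=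
  dual_system P Q M1 M2 rho /\ condV rho.

(* D is the operator coming from a dual family with data M1 and rho: from
   P_n(x) = M1(n) Q_x(rho(n)) M2(x), the recurrence in x reads
   P_n . D = M1(n) rho(n) M1(n)^-1 P_n. *)
Definition associated (C : fieldType) (N : nat) (P : nat -> {poly 'M[C]_N.+1})
    (D : diffop C N) (M1 rho : nat -> 'M[C]_N.+1) : Prop :=
  forall n, psi_inv P D n = M1 n * rho n * (M1 n)^-1.

Definition Upsilon (C : fieldType) (N : nat) (D : diffop C N) (x : nat) :
    'M[C]_N.+1 :=
  \prod_(k < x) (evalmx (D 1) k%:R)^-1.

(* Main.v *)
Require Import Defs.
From mathcomp Require Import all_boot all_order all_algebra finmap complex reals.
From mathcomp Require Import boolp classical_sets functions topology normedtype.
From mathcomp Require Import sequences ring.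

Set Implicit Arguments.
Unset Strict Implicit.
Unset Printing Implicit Defensive.

Import Order.TTheory GRing.Theory Num.Theory.
Import numFieldNormedType.Exports.

Local Open Scope ring_scope.

(** Read P_n(x) = M1(n) Q_x(rho(n)) M2(x) as a change of variable that turns a
    difference equation of P_n in x into a recurrence of Q_x in x: multiplying
    the three term recurrence by M1(n) on the left and M2(x) on the right gives,
    at the nonnegative integers x, the eigenvalue equation of P_n for a second
    order operator with eigenvalue M1(n) rho(n) M1(n)^-1, and conversely. What
    has to be proved is that the correspondence survives the passage between
    rational functions and their values at integers, and what happens at x = 0,
    where P_n(-1) has no counterpart among the Q_x.

    Rational functions. Matrices of rational functions that take equal values
    at all positive integers are equal ([mx_has_value_eq]). The three
    coefficients of a second order operator can be solved for from its action
    on P_0, P_1, P_2 ([second_order_act1], [second_order_act2]). Hence the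
    eigenvalues determine the operator ([second_order_act_inj]), and its
    coefficients have no poles ([in_BR_regular]), so that the eigenvalue
    equation may be evaluated at every integer.

    From a dual family to an operator ([dual_family_operator]). The coefficient
    of P_n(x+1) is rational by hypothesis; the equations for n = 0 and n = 1
    then express the other two rationally, so the recurrence at x >= 1 becomes
    an identity of rational functions. Evaluated at x = 0 it differs from the
    recurrence at 0 by P_n(-1) F_(-1)(0), which is thus P_n(0) times a matrix
    independent of n.

    From an operator to a dual sequence. Orthogonality with respect to a
    positive definite weight on the nonnegative integers makes every P_n(0)
    invertible ([mvop_horner0_unit]), and the Q_x are built by their recurrence
    ([dual_poly_values]). The factorization by itself gives the block
    Vandermonde condition at k_i = i ([dual_block_vandermonde]), because a
    combination of P_0, ..., P_x with x + 1 zeros is zero; and this condition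
    says that a polynomial is known from its values at the rho(n), whence
    uniqueness ([dual_polys_unique]). *)

(** * Matrix polynomials at scalar points *)

Section ScalarEvaluation.
Variables (C : numFieldType) (N : nat).
Implicit Types p q : {poly 'M[C]_N.+1}.

(** The polynomial entries through which [shiftmx] reads a polynomial with
    matrix coefficients as a matrix of polynomials. *)
Definition entry_poly p (a b : 'I_N.+1) : {poly C} :=
  \poly_(k < size p) p`_k a b.

Lemma horner_entry_poly p a b c : (entry_poly p a b).[c] = p.[c%:M] a b.
Proof.
rewrite horner_poly horner_coef summxE; apply: eq_bigr => k _.
by rewrite -(rmorphXn (@scalar_mx C N.+1)) -mulmxE mul_mx_scalar mxE mulrC.
Qed.

Lemma natr_scalar_mx (x : nat) : x%:R = (x%:R : C)%:M :> 'M[C]_N.+1.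
Proof. by rewrite raddfMn. Qed.

Lemma polymx_eq0 p (s : seq nat) :
  uniq s -> (size p <= size s)%N ->
  (forall x, x \in s -> p.[x%:R] = 0) -> p = 0.
Proof.
move=> s_uniq le_ps p_s; apply/polyP => k; rewrite coef0.
apply/matrixP => a b; rewrite mxE.
have pab0 : entry_poly p a b = 0.
  apply: (@roots_geq_poly_eq0 _ _ [seq x%:R | x <- s]).
  - apply/allP => _ /mapP[x sx ->].
    by rewrite rootE horner_entry_poly -natr_scalar_mx p_s // mxE.
  - by rewrite map_inj_uniq // => x y /eqP; rewrite eqr_nat => /eqP.
  - by rewrite size_map (leq_trans (size_poly _ _)).
have /(congr1 (fun f : {poly C} => f`_k)) := pab0.
rewrite coef_poly coef0; case: ltnP => // le_pk _.
by rewrite nth_default // mxE.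
Qed.

End ScalarEvaluation.

(** * Values of matrices of rational functions *)

Section Values.
Variable C : numFieldType.
Implicit Types f g : ratfun C.

Lemma has_value_polyC (c a : C) : has_value (tofrac c%:P) a c.
Proof.
by exists c%:P, 1; rewrite rmorph1 divr1 !hornerC divr1 oner_eq0.
Qed.

Lemma has_value_poly (p : {poly C}) (a : C) : has_value (tofrac p) a p.[a].
Proof. by exists p, 1; rewrite rmorph1 divr1 !hornerC divr1 oner_eq0. Qed.

Lemma tofrac_neq0 (q : {poly C}) a : q.[a] != 0 -> tofrac q != 0.
Proof. by rewrite tofrac_eq0; apply: contraNneq => ->; rewrite horner0. Qed.

Lemma has_valueD f g a u v :
  has_value f a u -> has_value g a v -> has_value (f + g) a (u + v).
Proof.
move=> [p [q [q0 -> ->]]] [p' [q' [q0' -> ->]]].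
exists (p * q' + p' * q), (q * q'); rewrite hornerM mulf_neq0 //; split=> //.
- rewrite tofracD !tofracM.
  exact: addf_div (tofrac_neq0 q0) (tofrac_neq0 q0').
- by rewrite addf_div // hornerD !hornerM.
Qed.

Lemma has_valueM f g a u v :
  has_value f a u -> has_value g a v -> has_value (f * g) a (u * v).
Proof.
move=> [p [q [q0 -> ->]]] [p' [q' [q0' -> ->]]].
exists (p * p'), (q * q'); rewrite hornerM mulf_neq0 //; split=> //.
- rewrite !tofracM; exact: mulf_div.
- by rewrite mulf_div hornerM.
Qed.

Lemma has_value0 a : has_value (0 : ratfun C) a 0.
Proof. by have := has_value_poly 0 a; rewrite rmorph0 horner0. Qed.

Lemma has_valueN f a u : has_value f a u -> has_value (- f) a (- u).
Proof.
move=> fu; rewrite -mulN1r -[- u]mulN1r; apply: has_valueM fu.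
by have := has_value_polyC (-1) a; rewrite !rmorphN !rmorph1.
Qed.

Lemma has_value_sum (I : Type) (r : seq I) (F : I -> ratfun C) (u : I -> C) a :
  (forall i, has_value (F i) a (u i)) ->
  has_value (\sum_(i <- r) F i) a (\sum_(i <- r) u i).
Proof.
move=> Fu; elim: r => [|i r IH]; first by rewrite !big_nil; apply: has_value0.
by rewrite !big_cons; apply: has_valueD.
Qed.

Lemma has_value_of_eq0 a v : has_value (0 : ratfun C) a v -> v = 0.
Proof.
move=> [p [q [q0 /eqP]]]; rewrite eq_sym mulf_eq0 invr_eq0.
rewrite (negPf (tofrac_neq0 q0)) orbF tofrac_eq0 => /eqP -> ->.
by rewrite horner0 mul0r.
Qed.

Lemma has_value_unique f a u v : has_value f a u -> has_value f a v -> u = v.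
Proof.
move=> fu /has_valueN/(has_valueD fu); rewrite subrr => /has_value_of_eq0.
by move/eqP; rewrite subr_eq0 => /eqP.
Qed.

(** A fraction fixed once by its value at 1 has a numerator vanishing at every
    positive integer, although the witnesses for its values differ from one
    point to the next. *)
Lemma has_value_eq0 f : (forall x : nat, has_value f x.+1%:R 0) -> f = 0.
Proof.
move=> f0; have [p [q [q1 fE _]]] := f0 0%N.
suff p0 : p = 0 by rewrite fE p0 rmorph0 mul0r.
apply: (@roots_geq_poly_eq0 _ _ [seq x.+1%:R | x <- iota 0 (size p)]); last first.
- by rewrite size_map size_iota.
- rewrite map_inj_uniq ?iota_uniq // => x y /eqP.
  by rewrite eqr_nat eqSS => /eqP.
apply/allP => _ /mapP[x _ ->]; rewrite rootE.
have : has_value (tofrac p) x.+1%:R 0.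
  have -> : tofrac p = f * tofrac q by rewrite fE divfK ?(tofrac_neq0 q1).
  by rewrite -(mul0r q.[x.+1%:R]); apply: has_valueM (has_value_poly _ _).
by move/has_value_unique/(_ (has_value_poly _ _)) => <-.
Qed.

End Values.

Section MatrixValues.
Variables (C : numFieldType) (N : nat).
Implicit Types F G : 'M[ratfun C]_N.+1.

Definition mx_has_value F (a : C) (V : 'M[C]_N.+1) : Prop :=
  forall i j, has_value (F i j) a (V i j).

Definition constmx (A : 'M[C]_N.+1) : 'M[ratfun C]_N.+1 :=
  map_mx (fun c : C => tofrac c%:P) A.

Lemma mx_has_valueD F G a U V :
  mx_has_value F a U -> mx_has_value G a V -> mx_has_value (F + G) a (U + V).
Proof. by move=> FU GV i j; rewrite !mxE; apply: has_valueD. Qed.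

Lemma mx_has_valueN F a U : mx_has_value F a U -> mx_has_value (- F) a (- U).
Proof. by move=> FU i j; rewrite !mxE; apply: has_valueN. Qed.

Lemma mx_has_valueB F G a U V :
  mx_has_value F a U -> mx_has_value G a V -> mx_has_value (F - G) a (U - V).
Proof. by move=> FU /mx_has_valueN; apply: mx_has_valueD. Qed.

Lemma mx_has_valueM F G a U V :
  mx_has_value F a U -> mx_has_value G a V -> mx_has_value (F * G) a (U * V).
Proof.
move=> FU GV i j; rewrite !mxE.
by apply: has_value_sum => k; apply: has_valueM.
Qed.

Lemma mx_has_value_const A a : mx_has_value (constmx A) a A.
Proof. by move=> i j; rewrite !mxE; apply: has_value_polyC. Qed.

Lemma mx_has_value0 a : mx_has_value (0 : 'M[ratfun C]_N.+1) a 0.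
Proof. by move=> i j; rewrite !mxE; apply: has_value0. Qed.

Lemma mx_has_value1 a : mx_has_value (1 : 'M[ratfun C]_N.+1) a 1.
Proof.
move=> i j; rewrite !mxE; case: (i == j); last exact: has_value0.
by have := has_value_polyC (1 : C) a; rewrite !rmorph1.
Qed.

Lemma mx_has_value_shift (p : {poly 'M[C]_N.+1}) (j : int) a :
  mx_has_value (shiftmx j p) a p.[(a + j%:~R)%:M].
Proof.
move=> k l; rewrite !mxE -horner_entry_poly.
have -> : (entry_poly p k l).[a + j%:~R] =
          (entry_poly p k l \Po ('X + (j%:~R)%:P)).[a].
  by rewrite horner_comp hornerD hornerX hornerC.
exact: has_value_poly.
Qed.

Lemma mx_has_value_unique F a U V :
  mx_has_value F a U -> mx_has_value F a V -> U = V.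
Proof.
by move=> FU FV; apply/matrixP => i j; apply: has_value_unique (FU i j) (FV i j).
Qed.

Lemma evalmxE F a V : mx_has_value F a V -> evalmx F a = V.
Proof.
move=> FV; apply/matrixP => i j; rewrite !mxE.
apply: xget_unique => [|v Fv]; first exact: FV.
exact: has_value_unique Fv (FV i j).
Qed.

Lemma mx_has_value_eq F G (V : nat -> 'M[C]_N.+1) :
  (forall x : nat, mx_has_value F x.+1%:R (V x)) ->
  (forall x : nat, mx_has_value G x.+1%:R (V x)) -> F = G.
Proof.
move=> FV GV; apply/eqP; rewrite -subr_eq0; apply/eqP/matrixP => i j.
rewrite [RHS]mxE; apply: has_value_eq0 => x.
by have := mx_has_valueB (FV x) (GV x) i j; rewrite subrr [X in has_value _ _ X]mxE.
Qed.

End MatrixValues.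

(** * Nonsingularity of the values at zero *)

Section Orthogonality.
Variables (C : numClosedFieldType) (N : nat).
Local Open Scope classical_set_scope.
Local Open Scope sesquilinear_scope.

Definition null_series (u : nat -> C) : Prop := series u @ \oo --> (0 : C).

Lemma null_series0 : null_series (fun=> 0).
Proof.
rewrite /null_series (_ : series _ = fun=> 0); first exact: cvg_cst.
by apply/funext => n; rewrite /series /= big1.
Qed.

Lemma null_seriesD u v :
  null_series u -> null_series v -> null_series (fun x => u x + v x).
Proof.
move=> u0 v0; rewrite /null_series -[0 in X in _ --> X]addr0.
rewrite (_ : series _ = series u + series v); first exact: cvgD.
by apply/funext => n; rewrite /series /= big_split.
Qed.

Lemma null_seriesM c d u : null_series u -> null_series (fun x => c * u x * d).
Proof.
move=> u0; rewrite /null_series (_ : series _ = fun n => c * series u n * d).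
  have -> : 0 = c * 0 * d by rewrite mulr0 mul0r.
  by apply: cvgMr_tmp; apply: cvgMl_tmp.
by apply/funext => n; rewrite /series /= mulr_sumr mulr_suml.
Qed.

Lemma null_series_sum (I : Type) (r : seq I) (u : I -> nat -> C) :
  (forall i, null_series (u i)) -> null_series (fun x => \sum_(i <- r) u i x).
Proof.
move=> u0; elim: r => [|i r IH].
  rewrite (_ : (fun x => _) = fun=> 0); first exact: null_series0.
  by apply/funext => x; rewrite big_nil.
rewrite (_ : (fun x => _) = fun x => u i x + \sum_(i <- r) u i x).
  exact: null_seriesD.
by apply/funext => x; rewrite big_cons.
Qed.

(** The order on the closed field is partial, but the partial sums stay above
    each of their terms, and a sequence converging to 0 cannot stay above a
    positive element in norm. *)
Lemma null_series_ge0 (u : nat -> C) :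
  (forall x, 0 <= u x) -> null_series u -> forall x, u x = 0.
Proof.
move=> u_ge0 u0 x; apply/eqP/negPn/negP => ux_neq0.
have ux_gt0 : 0 < u x by rewrite lt_def ux_neq0 u_ge0.
have /= [k _ lt_k] := cvgr0_norm_lt _ u0 _ ux_gt0.
have le_s : u x <= series u (maxn k x.+1).
  rewrite /series /= (@big_cat_nat _ _ _ x.+1) //=; last exact: leq_maxr.
  rewrite big_nat_recr //= -addrA [X in _ <= X]addrC -addrA lerDl.
  by rewrite addr_ge0 // sumr_ge0.
have := lt_k (maxn k x.+1) (leq_maxl _ _).
rewrite ger0_norm ?(le_trans _ le_s) // => /(le_lt_trans le_s).
by rewrite ltxx.
Qed.

Definition mx_null_series (u : nat -> 'M[C]_N.+1) : Prop :=
  forall i j, null_series (fun x => u x i j).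

Lemma mx_null_seriesM A B u :
  mx_null_series u -> mx_null_series (fun x => A * u x * B).
Proof.
move=> u0 i j.
rewrite (_ : (fun x => _) = fun x => \sum_l \sum_k A i k * u x k l * B l j).
  by do 2![apply: null_series_sum => ?]; apply: null_seriesM.
apply/funext => x; rewrite mxE; apply: eq_bigr => l _.
by rewrite mxE mulr_suml.
Qed.

Lemma mx_null_seriesD u v :
  mx_null_series u -> mx_null_series v -> mx_null_series (fun x => u x + v x).
Proof.
move=> u0 v0 i j.
rewrite (_ : (fun x => _) = fun x => u x i j + v x i j); first exact: null_seriesD.
by apply/funext => x; rewrite mxE.
Qed.

Variable W : int -> 'M[C]_N.+1.

Definition orthogonal_polys (p q : {poly 'M[C]_N.+1}) : Prop :=
  mx_null_series (fun x : nat => p.[x%:R] * W x * q.[x%:R]^t*).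

Lemma is_inner_product_ortho p q :
  is_inner_product W p q 0 -> orthogonal_polys p q.
Proof.
move=> pq0 i j; rewrite /null_series.
have := cvg_comp _ _ pq0 (@coord_continuous _ _ _ i j 0); rewrite mxE.
apply: cvg_trans; apply: near_eq_cvg; near=> n.
by rewrite /series /= summxE.
Unshelve. all: by end_near. Qed.

Lemma orthogonal_polysMl A p q :
  orthogonal_polys p q -> orthogonal_polys (A%:P * p) q.
Proof.
move=> /(@mx_null_seriesM A 1); congr mx_null_series.
by apply/funext => x; rewrite hornerCM mulr1 !mulrA.
Qed.

Lemma orthogonal_polysMr A p q :
  orthogonal_polys p q -> orthogonal_polys p (A%:P * q).
Proof.
move=> /(@mx_null_seriesM 1 (A^t*)); congr mx_null_series.
apply/funext => x; rewrite hornerCM mul1r -!mulrA; congr (_ * (_ * _)).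
by rewrite -!mulmxE trmx_mul map_mxM.
Qed.

Lemma orthogonal_polysDr p q r :
  orthogonal_polys p q -> orthogonal_polys p r -> orthogonal_polys p (q + r).
Proof.
move=> pq /(mx_null_seriesD pq); congr mx_null_series.
by apply/funext => x; rewrite hornerD linearD /= map_mxD mulrDr.
Qed.

Variable P : nat -> {poly 'M[C]_N.+1}.
Hypothesis hW : is_weight W.
Hypothesis hP : is_monic_mvop W P.

(** A polynomial of degree less than n is a left combination of P_0, ...,
    P_(n-1), obtained by removing leading terms one at a time. *)
Lemma mvop_orthogonal_lower n (r : {poly 'M[C]_N.+1}) :
  (size r <= n)%N -> orthogonal_polys (P n) r.
Proof.
case: hP => Pmonic [H PH].
suff lower m (q : {poly 'M[C]_N.+1}) :
    (m <= n)%N -> (size q <= m)%N -> orthogonal_polys (P n) q by apply: lower.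
elim: m q => [q _|m IH {}r le_mn le_r].
  rewrite leqn0 size_poly_eq0 => /eqP -> i j.
  rewrite (_ : (fun x => _) = fun=> 0); first exact: null_series0.
  by apply/funext => x; rewrite horner0 linear0 map_mx0 mulr0 mxE.
have [/monicP lcP sP] := Pmonic m.
rewrite -[r](subrK ((r`_m)%:P * P m)) addrC; apply: orthogonal_polysDr.
  apply/orthogonal_polysMr/is_inner_product_ortho.
  by have := PH n m; rewrite gtn_eqF.
apply: IH; first exact: ltnW.
apply/leq_sizeP => k le_mk; rewrite coefB coefCM.
move: le_mk; rewrite leq_eqVlt => /predU1P[<-|lt_mk].
  by move: lcP; rewrite lead_coefE sP /= => ->; rewrite mulr1 subrr.
by rewrite (nth_default _ (leq_trans le_r lt_mk)) [(P m)`_k]nth_default ?sP // mulr0 subrr.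
Qed.

(** If A P_n(0) = 0 then A P_n(x) = x R(x) with deg R < n, so orthogonality
    makes the sum over x of x R(x) W(x) R(x)^* vanish; all its diagonal terms
    are nonnegative, which forces R to vanish at every positive integer. *)
Lemma mvop_horner0_unit n : (P n).[0] \in unitmx.
Proof.
have [Pmonic _] := hP; have [/monicP lcP sP] := Pmonic n.
rewrite -row_free_unit; apply: inj_row_free => v vP0.
(* Repeating v as every row keeps the argument inside square matrices. *)
pose A : 'M[C]_N.+1 := \matrix_i v.
have AP0 : A * (P n).[0] = 0.
  by apply/row_matrixP => i; rewrite -mulmxE row_mul rowK vP0 row0.
suff A0 : A = 0 by have := rowK (fun=> v) ord0 : row ord0 A = v; rewrite A0 row0.
pose r : {poly 'M[C]_N.+1} := \poly_(k < n) (A * (P n)`_k.+1).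
have rE : A%:P * P n = r * 'X.
  apply/polyP => k; rewrite coefCM coefMX coef_poly.
  case: k => [|k] /=; first by rewrite -horner_coef0.
  by case: ltnP => // le_nk; rewrite [_`_k.+1]nth_default ?mulr0 // sP.
have rW0 : orthogonal_polys (A%:P * P n) r.
  by apply/orthogonal_polysMl/mvop_orthogonal_lower/size_poly.
have [Wpos _ _] := hW.
have r_eq0 x : r.[x.+1%:R] = 0.
  apply/row_matrixP => i; rewrite row0.
  have quadE y : ((A%:P * P n).[y%:R] * W y * r.[y%:R]^t*) i i =
      y%:R * (row i r.[y%:R] *m W y *m (row i r.[y%:R])^t*) ord0 ord0.
    rewrite rE hornerMX natr_scalar_mx -mulmxE mul_mx_scalar.
    rewrite -!scalemxAl mxE; congr (_ * _).
    rewrite -!row_mul !mxE; apply: eq_bigr => k _; rewrite !mxE.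
    by congr (_ * _); apply: eq_bigr => l _; rewrite !mxE.
  have quad_ge0 y : 0 <= (row i r.[y%:R] *m W y *m (row i r.[y%:R])^t*) ord0 ord0.
    have [->|/(proj2 (Wpos y))/ltW//] := eqVneq (row i r.[y%:R]) 0.
    by rewrite !mul0mx mxE.
  have [//|/(proj2 (Wpos x.+1))] := eqVneq (row i r.[x.+1%:R]) 0.
  suff -> : (row i r.[x.+1%:R] *m W x.+1 *m (row i r.[x.+1%:R])^t*) ord0 ord0 = 0.
    by rewrite ltxx.
  have/eqP: x.+1%:R * (row i r.[x.+1%:R] *m W x.+1 *m (row i r.[x.+1%:R])^t*) ord0 ord0 = 0.
    by rewrite -quadE (null_series_ge0 _ (rW0 i i)) // => y; rewrite quadE mulr_ge0.
  by rewrite mulf_eq0 pnatr_eq0 => /eqP.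
have r0 : r = 0.
  apply: (@polymx_eq0 _ _ _ (iota 1 (size r))) => [||x].
  - exact: iota_uniq.
  - by rewrite size_iota.
  - by rewrite mem_iota; case: x => // x _; apply: r_eq0.
have := congr1 (fun p : {poly _} => p`_n) rE.
rewrite r0 mul0r coef0 coefCM.
by move: lcP; rewrite lead_coefE sP /= => ->; rewrite mulr1.
Qed.

End Orthogonality.

(** * Second order operators *)

Section SecondOrder.
Variables (C : numFieldType) (N : nat).
Implicit Types (p : {poly 'M[C]_N.+1}) (D E : diffop C N).

(** The support of an operator of second order may be smaller than 1, 0, -1;
    the missing terms are zero. *)
Lemma act_second_order p D : second_order D ->
  act p D = shiftmx 1 p * D 1 + shiftmx 0 p * D 0 + shiftmx (-1) p * D (-1).
Proof.
move=> D2; rewrite /act.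
have -> : \sum_(j <- finsupp D) shiftmx j p * D j =
          \sum_(j <- [:: 1; 0; -1]) shiftmx j p * D j.
  rewrite [RHS](bigID (mem (finsupp D))) /= [X in _ + X]big1 ?addr0; last first.
    by move=> j /fsfun_dflt ->; rewrite mulr0.
  rewrite -[RHS]big_filter; apply: perm_big; apply: uniq_perm.
  - exact: fset_uniq.
  - exact: filter_uniq.
  move=> j; rewrite mem_filter; case: (boolP (j \in finsupp D)) => //= Dj.
  apply/esym; apply: contraLR Dj => /D2 Dj0.
  by rewrite mem_finsupp negbK Dj0.
by rewrite !big_cons big_nil addr0 addrA.
Qed.

Lemma second_order_eq D E : second_order D -> second_order E ->
  D 1 = E 1 -> D 0 = E 0 -> D (-1) = E (-1) -> D = E.
Proof.
move=> D2 E2 e1 e0 em1; apply/fsfunP => j.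
have [|jn] := boolP (j \in [:: 1; 0; -1]); last by rewrite D2 ?E2.
by rewrite !inE => /or3P[] /eqP ->.
Qed.

Lemma second_order_exists (F1 F0 Fm1 : 'M[ratfun C]_N.+1) :
  exists D : diffop C N,
    [/\ second_order D, D 1 = F1, D 0 = F0 & D (-1) = Fm1].
Proof.
pose D : diffop C N := [fsfun j in [fset 1; 0; -1]%fset =>
  if j == 1 then F1 else if j == 0 then F0 else Fm1].
exists D; split; rewrite ?fsfunE ?inE //= => j jn.
by rewrite fsfunE !inE; move: jn; rewrite !inE orbA => /negPf ->.
Qed.

Lemma mx_has_value_act D a p (V1 V0 Vm1 : 'M[C]_N.+1) : second_order D ->
  mx_has_value (D 1) a V1 -> mx_has_value (D 0) a V0 ->
  mx_has_value (D (-1)) a Vm1 ->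
  mx_has_value (act p D) a
    (p.[(a + 1)%:M] * V1 + p.[a%:M] * V0 + p.[(a - 1)%:M] * Vm1).
Proof.
move=> D2 h1 h0 hm1; rewrite act_second_order //.
apply: mx_has_valueD; first apply: mx_has_valueD.
- exact: mx_has_valueM (mx_has_value_shift _ _ _) h1.
- by rewrite -[X in p.[X%:M]]addr0; apply: mx_has_valueM (mx_has_value_shift _ _ _) h0.
- exact: mx_has_valueM (mx_has_value_shift _ _ _) hm1.
Qed.

Variable P : nat -> {poly 'M[C]_N.+1}.
Hypothesis Pmonic : forall n, P n \is monic /\ size (P n) = n.+1.

Lemma monic_seq0 : P 0 = 1.
Proof.
have [Pm /eqP/size_poly1P[c _ Pc]] := Pmonic 0.
by move: Pm; rewrite Pc monicE lead_coefC => /eqP ->.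
Qed.

(** The leading coefficient of P_n is the identity, so a constant matrix that
    annihilates P_n on the left is zero. *)
Lemma is_eigen_unique n D G G' :
  is_eigen (P n) D G -> is_eigen (P n) D G' -> G = G'.
Proof.
rewrite /is_eigen => -> /eqP; rewrite -subr_eq0 -mulrBl => /eqP GG'0.
have [/monicP lcP sP] := Pmonic n.
have : (G - G')%:P * P n = 0.
  apply: (@polymx_eq0 _ _ _ (iota 0 (size ((G - G')%:P * P n)))) => [||x _].
  - exact: iota_uniq.
  - by rewrite size_iota.
  rewrite hornerCM natr_scalar_mx.
  suff : mx_has_value 0 (x%:R : C) ((G - G') * (P n).[(x%:R)%:M]).
    move/mx_has_value_unique; apply; exact: mx_has_value0.
  rewrite -GG'0.
  rewrite -[X in (_ * _.[X%:M])%R](addr0 x%:R).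
  apply: mx_has_valueM (mx_has_value_shift _ 0 _).
  by apply: mx_has_valueB; apply: mx_has_value_const.
move/(congr1 (fun p : {poly _} => p`_n)); rewrite coefCM coef0.
move: lcP; rewrite lead_coefE sP /= => ->.
by rewrite mulr1 => /eqP; rewrite subr_eq0 => /eqP.
Qed.

Lemma psi_invE n D G : is_eigen (P n) D G -> psi_inv P D n = G.
Proof. by move=> DG; apply: xget_unique => // G' /is_eigen_unique; apply. Qed.

Lemma psi_invP n D : in_BR P D -> is_eigen (P n) D (psi_inv P D n).
Proof. by case=> G DG; rewrite (psi_invE (DG n)). Qed.

Lemma shift_monic_seq0 j : shiftmx j (P 0) = 1.
Proof.
apply: (@mx_has_value_eq _ _ _ _ (fun=> 1)) => x.
  by have := mx_has_value_shift (P 0) j x.+1%:R; rewrite monic_seq0 hornerC.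
exact: mx_has_value1.
Qed.

Lemma horner_monic1 c : (P 1).[c%:M] = (P 1)`_0 + c%:M.
Proof.
have [/monicP lcP sP] := Pmonic 1; move: lcP; rewrite lead_coefE sP /= => lcP.
by rewrite horner_coef sP !big_ord_recl big_ord0 /= lcP mulr1 mul1r addr0 expr1.
Qed.

Lemma horner_monic2 c : (P 2).[c%:M] = (P 2)`_0 + (P 2)`_1 * c%:M + (c ^+ 2)%:M.
Proof.
have [/monicP lcP sP] := Pmonic 2; move: lcP; rewrite lead_coefE sP /= => lcP.
rewrite horner_coef sP !big_ord_recl big_ord0 /= lcP mulr1 mul1r addr0 expr1.
by rewrite addrA -rmorphXn.
Qed.

Lemma shift_monic1 : shiftmx 1 (P 1) = shiftmx 0 (P 1) + 1.
Proof.
pose V (x : nat) := (P 1).[(x.+1%:R + (1 : int)%:~R)%:M].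
apply: (@mx_has_value_eq _ _ _ _ V) => x; first exact: mx_has_value_shift.
have -> : V x = (P 1).[(x.+1%:R + (0 : int)%:~R)%:M] + 1.
  by rewrite /V !horner_monic1 mulr0z addr0 raddfD /= addrA.
apply: mx_has_valueD; [exact: mx_has_value_shift | exact: mx_has_value1].
Qed.

Lemma shift_monic1N : shiftmx (-1) (P 1) = shiftmx 0 (P 1) - 1.
Proof.
pose V (x : nat) := (P 1).[(x.+1%:R + (-1 : int)%:~R)%:M].
apply: (@mx_has_value_eq _ _ _ _ V) => x; first exact: mx_has_value_shift.
have -> : V x = (P 1).[(x.+1%:R + (0 : int)%:~R)%:M] - 1.
  by rewrite /V !horner_monic1 mulr0z addr0 mulrN1z raddfB /= addrA.
apply: mx_has_valueB; [exact: mx_has_value_shift | exact: mx_has_value1].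
Qed.

(** This constant is invertible, which is what allows the system formed by the
    actions on P_0, P_1, P_2 to be solved for the coefficients. *)
Lemma second_difference_monic2 :
  (shiftmx 1 (P 2) - shiftmx 0 (P 2)) + (shiftmx (-1) (P 2) - shiftmx 0 (P 2))
    = 2%:R.
Proof.
apply: (@mx_has_value_eq _ _ _ _ (fun=> 2%:R)) => x; last first.
  by rewrite -[2%:R]/(1 + 1); apply: mx_has_valueD; apply: mx_has_value1.
have -> : 2%:R = ((P 2).[(x.+1%:R + (1 : int)%:~R)%:M]
                   - (P 2).[(x.+1%:R + (0 : int)%:~R)%:M])
              + ((P 2).[(x.+1%:R + (-1 : int)%:~R)%:M]
                   - (P 2).[(x.+1%:R + (0 : int)%:~R)%:M]) :> 'M[C]_N.+1.
  set y : C := x.+1%:R.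
  rewrite !horner_monic2 mulr0z mulr1z mulrN1z addr0 sqrrD sqrrB !raddfD !raddfN.
  rewrite /= !mulrDr mulrN expr1n mulr1 -[1%:M]/1 mulr1.
  set Y := (P 2)`_1 * _; apply/matrixP => i j; rewrite !mxE; ring.
by do ![apply: mx_has_valueD | apply: mx_has_valueN | apply: mx_has_value_shift].
Qed.

End SecondOrder.

Section Elimination.
Variables (R : comNzRingType) (N : nat).

(** Once the products are expanded, these noncommutative identities are
    additive, so they hold entry by entry in the commutative ring R. In the use
    made of them p is P_1(x), and q, q1, qm are P_2 at x, x + 1, x - 1. *)
Lemma elimination_first (p D1 D0 Dm : 'M[R]_N.+1) :
  ((p + 1) * D1 + p * D0 + (p - 1) * Dm) - p * (D1 + D0 + Dm) = D1 - Dm.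
Proof.
rewrite !mulrDl !mulrDr mulNr !mul1r.
move: (p * D1) (p * D0) (p * Dm) => u v w.
by apply/matrixP => i j; rewrite !mxE; ring.
Qed.

Lemma elimination_second (q q1 qm D1 D0 Dm : 'M[R]_N.+1) :
  (q1 - q) + (qm - q) = 2%:R ->
  (q1 * D1 + q * D0 + qm * Dm) - q * (D1 + D0 + Dm) + (qm - q) * (D1 - Dm)
    = 2%:R * D1.
Proof.
move=> <-; rewrite !mulrDl !mulrDr !mulNr !mulrN.
move: (q * D1) (q * D0) (q * Dm) (q1 * D1) (qm * D1) (qm * Dm) => u v w x y z.
by apply/matrixP => i j; rewrite !mxE; ring.
Qed.

End Elimination.

Section Recovery.
Variables (C : numFieldType) (N : nat) (P : nat -> {poly 'M[C]_N.+1}).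
Hypothesis Pmonic : forall n, P n \is monic /\ size (P n) = n.+1.
Implicit Types (D E : diffop C N) (F G : 'M[ratfun C]_N.+1).

Lemma second_order_act0 D : second_order D -> act (P 0) D = D 1 + D 0 + D (-1).
Proof. by move=> D2; rewrite act_second_order // !shift_monic_seq0 // !mul1r. Qed.

Lemma second_order_act1 D : second_order D ->
  act (P 1) D - shiftmx 0 (P 1) * act (P 0) D = D 1 - D (-1).
Proof.
move=> D2; rewrite second_order_act0 // act_second_order //.
by rewrite shift_monic1 // shift_monic1N // elimination_first.
Qed.

Lemma second_order_act2 D : second_order D ->
  act (P 2) D - shiftmx 0 (P 2) * act (P 0) D +
    (shiftmx (-1) (P 2) - shiftmx 0 (P 2)) *
    (act (P 1) D - shiftmx 0 (P 1) * act (P 0) D) = 2%:R * D 1.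
Proof.
move=> D2; rewrite second_order_act1 // second_order_act0 // act_second_order //.
exact: elimination_second (second_difference_monic2 Pmonic).
Qed.

Lemma half_mxratfun : exists H : 'M[ratfun C]_N.+1,
  H * 2%:R = 1 /\ forall a, mx_has_value H a (2^-1)%:M.
Proof.
exists (constmx (2^-1)%:M); split=> [|a]; last exact: mx_has_value_const.
apply: (@mx_has_value_eq _ _ _ _ (fun=> 1)) => x; last exact: mx_has_value1.
have -> : 1 = (2^-1)%:M * (1 + 1) :> 'M[C]_N.+1.
  by rewrite -[1]/(1%:M) -raddfD -mulmxE -scalar_mxM mulVf ?pnatr_eq0.
apply: mx_has_valueM; first exact: mx_has_value_const.
by apply: mx_has_valueD; apply: mx_has_value1.
Qed.

(** An operator of second order is determined by its action on polynomials of
    degree at most 2. *)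
Lemma second_order_act_inj D E : second_order D -> second_order E ->
  (forall n, act (P n) D = act (P n) E) -> D = E.
Proof.
move=> D2 E2 DE; have [H [H2 _]] := half_mxratfun.
have D_2 := second_order_act2 D2; have D_1 := second_order_act1 D2.
have D_0 := second_order_act0 D2; rewrite !DE in D_2 D_1 D_0.
have e1 : D 1 = E 1.
  rewrite -[LHS]mul1r -[RHS]mul1r -H2 -[LHS]mulrA -[RHS]mulrA.
  by rewrite -D_2 -(second_order_act2 E2).
have em : D (-1) = E (-1).
  apply: oppr_inj; apply: (addrI (D 1)).
  by rewrite -[LHS]D_1 (second_order_act1 E2) e1.
have e0 : D 0 = E 0.
  apply: (addrI (D 1)); apply: (addIr (D (-1))).
  by rewrite -[LHS]D_0 (second_order_act0 E2) e1 em.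
exact: second_order_eq.
Qed.

(** Since [evalmx] returns 0 at a pole, this says that no entry has a pole. *)
Definition regular_at F (a : C) : Prop := mx_has_value F a (evalmx F a).

Lemma regularI F a V : mx_has_value F a V -> regular_at F a.
Proof. by move=> FV; rewrite /regular_at (evalmxE FV). Qed.

Lemma regularD F G a : regular_at F a -> regular_at G a -> regular_at (F + G) a.
Proof. by move=> Fa Ga; apply: regularI (mx_has_valueD Fa Ga). Qed.

Lemma regularB F G a : regular_at F a -> regular_at G a -> regular_at (F - G) a.
Proof. by move=> Fa Ga; apply: regularI (mx_has_valueB Fa Ga). Qed.

Lemma regularM F G a : regular_at F a -> regular_at G a -> regular_at (F * G) a.
Proof. by move=> Fa Ga; apply: regularI (mx_has_valueM Fa Ga). Qed.

Lemma regular_shift j p a : regular_at (shiftmx j p : 'M[ratfun C]_N.+1) a.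
Proof. exact: regularI (mx_has_value_shift _ _ _). Qed.

(** The eigenvalue equations for n = 0, 1, 2 can be solved for the three
    coefficients, in terms of matrices of polynomials only. *)
Lemma in_BR_regular D a : in_BR P D -> second_order D ->
  [/\ regular_at (D 1) a, regular_at (D 0) a & regular_at (D (-1)) a].
Proof.
move=> [G DG] D2; have [H [H2 Hhalf]] := half_mxratfun.
have ract n : regular_at (act (P n) D) a.
  rewrite DG; apply: regularM; last exact: regular_shift.
  exact: regularI (mx_has_value_const _ _).
have r1 : regular_at (D 1) a.
  rewrite -[D 1]mul1r -H2 -mulrA -(second_order_act2 D2).
  apply: regularM; first exact: regularI (Hhalf a).
  by do ![exact: ract | exact: regular_shift | apply: regularB | apply: regularM
         | apply: regularD].
have rm : regular_at (D (-1)) a.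
  have -> : D (-1) = D 1 - (act (P 1) D - shiftmx 0 (P 1) * act (P 0) D).
    by rewrite (second_order_act1 D2) subKr.
  by do ![exact: ract | exact: regular_shift | exact: r1 | apply: regularB
         | apply: regularM].
split=> //; have -> : D 0 = act (P 0) D - D 1 - D (-1).
  by rewrite (second_order_act0 D2) [RHS]addrAC addrK addrAC subrr add0r.
by do ![exact: ract | exact: r1 | exact: rm | apply: regularB].
Qed.

Lemma eigen_recurrence D n (G : 'M[C]_N.+1) (a : C) : in_BR P D -> second_order D ->
  is_eigen (P n) D G ->
  (P n).[(a + 1)%:M] * evalmx (D 1) a + (P n).[a%:M] * evalmx (D 0) a
    + (P n).[(a - 1)%:M] * evalmx (D (-1)) a = G * (P n).[a%:M].
Proof.
move=> DBR D2 DG; have [r1 r0 rm] := in_BR_regular a DBR D2.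
apply: mx_has_value_unique (mx_has_value_act (P n) D2 r1 r0 rm) _.
rewrite DG; apply: mx_has_valueM; first exact: mx_has_value_const.
by rewrite -[X in _.[X%:M]]addr0; apply: mx_has_value_shift.
Qed.

End Recovery.

(** * Block Vandermonde matrices *)

Section LeftEvaluation.
Variables (C : numFieldType) (N : nat).
Implicit Types (p q : {poly 'M[C]_N.+1}) (A B : 'M[C]_N.+1).

Lemma lhorner_wide n q A : (size q <= n)%N ->
  lhorner q A = \sum_(k < n) A ^+ k * q`_k.
Proof.
move=> le_qn; rewrite /lhorner (big_ord_widen _ (fun k => A ^+ k * q`_k) le_qn).
rewrite big_mkcond /=; apply: eq_bigr => k _; case: ltnP => // le_qk.
by rewrite nth_default // mulr0.
Qed.

Lemma lhorner1 A : lhorner 1 A = 1.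
Proof. by rewrite /lhorner size_poly1 big_ord1 expr0 mul1r coef1. Qed.

Lemma lhornerB p q A : lhorner (p - q) A = lhorner p A - lhorner q A.
Proof.
pose n := maxn (size p) (size q).
rewrite !(@lhorner_wide n) ?leq_maxl ?leq_maxr //; last first.
  by rewrite (leq_trans (size_polyD _ _)) // size_polyN.
by rewrite -sumrB; apply: eq_bigr => k _; rewrite coefB mulrBr.
Qed.

Lemma lhornerMX q A : lhorner (q * 'X) A = A * lhorner q A.
Proof.
rewrite (@lhorner_wide (size q).+1) ?(leq_trans (size_polyMleq _ _)) //; last first.
  by rewrite size_polyX addn2.
rewrite big_ord_recl coefMX mulr0 add0r [in RHS]/lhorner mulr_sumr; apply: eq_bigr => k _.
by rewrite coefMX /= exprS mulrA.
Qed.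

Lemma lhornerMC q B A : lhorner (q * B%:P) A = lhorner q A * B.
Proof.
rewrite (@lhorner_wide (size q)); last first.
  by apply/leq_sizeP => k le_qk; rewrite coefMC nth_default // mul0r.
by rewrite [in RHS]/lhorner mulr_suml; apply: eq_bigr => k _; rewrite coefMC mulrA.
Qed.

(** Invertibility by triviality of the left kernel, with the row vectors of the
    kernel replaced by families of square matrices, to which the evaluation of
    matrix polynomials applies. *)
Lemma block_vandermonde_unit x (r : 'I_x.+1 -> 'M[C]_N.+1) :
  (forall A : 'I_x.+1 -> 'M[C]_N.+1,
     (forall j : 'I_x.+1, \sum_i A i * r i ^+ j = 0) -> forall i, A i = 0) ->
  \mxblock_(i < x.+1, j < x.+1) (r i ^+ j) \in unitmx.
Proof.
move=> r_inj; rewrite -row_free_unit; apply: inj_row_free => v.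
rewrite -[v]submxrowK mul_mxrow_mxblock -mxrow0 => /eq_mxrowP vr0.
pose A (i : 'I_x.+1) : 'M[C]_N.+1 := \matrix_l submxrow v i.
have A0 : forall i, A i = 0.
  apply: r_inj => j; apply/row_matrixP => l; rewrite raddf_sum row0 /= -[RHS](vr0 j).
  by apply: eq_bigr => i _; rewrite -mulmxE row_mul rowK.
apply: eq_mxrow => i.
by have := rowK (fun=> submxrow v i) ord0 : row ord0 (A i) = _; rewrite A0 row0.
Qed.

(** The coefficients of q, stacked in a column, lie in the right kernel of the
    block Vandermonde matrices of rho. *)
Lemma block_vandermonde_lhorner_eq0 (rho : nat -> 'M[C]_N.+1) q :
  block_vandermonde rho -> (forall n, lhorner q (rho n) = 0) -> q = 0.
Proof.
move=> V q0; apply/polyP => j; rewrite coef0.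
(* Large enough to see both all the coefficients of q and the index j. *)
have [k Vk] := V (size q + j)%N; set x := (size q + j)%N in k Vk *.
have le_jx : (j < x.+1)%N by rewrite ltnS leq_addl.
have : \mxcol_(l < x.+1) q`_l = 0 :> 'M[C]_(_, N.+1).
  rewrite -[LHS](mulKmx Vk) mul_mxblock_mxrow (_ : \mxcol_i _ = 0) ?mulmx0 //.
  rewrite -mxcol0; apply: eq_mxcol => i; rewrite -[RHS](q0 (k i)).
  by rewrite (@lhorner_wide x.+1) // ltnW // ltnS leq_addr.
by rewrite -mxcol0 => /eq_mxcolP/(_ (Ordinal le_jx)).
Qed.

End LeftEvaluation.

Section DualSystems.
Variables (C : numFieldType) (N : nat) (P : nat -> {poly 'M[C]_N.+1}).
Hypothesis Pmonic : forall n, P n \is monic /\ size (P n) = n.+1.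

Lemma coef_monic_seq n : (P n)`_n = 1.
Proof.
by have [/monicP lcP sP] := Pmonic n; move: lcP; rewrite lead_coefE sP.
Qed.

Lemma monic_seq_free n (B : nat -> 'M[C]_N.+1) :
  \sum_(i < n) (B i)%:P * P i = 0 -> forall i, (i < n)%N -> B i = 0.
Proof.
elim: n => // n IH; rewrite big_ord_recr /= => BP0.
have Bn : B n = 0.
  move: (congr1 (fun p : {poly _} => p`_n) BP0).
  rewrite coefD coefCM coef_monic_seq mulr1 coef0 coef_sum big1 ?add0r // => i _.
  by rewrite coefCM nth_default ?mulr0 // (Pmonic i).2.
move: BP0; rewrite Bn mul0r addr0 => /IH B0 i.
by rewrite ltnS leq_eqVlt => /predU1P[-> //|/B0].
Qed.

(** Through P_n(x) = M1(n) Q_x(rho(n)) M2(x), a left dependency between the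
    block rows rho(i)^j, i <= x, becomes one between the rows (P_i(j))_j, that
    is, a combination of P_0, ..., P_x with x + 1 zeros. *)
Lemma dual_block_vandermonde (Q : nat -> {poly 'M[C]_N.+1})
    (M1 M2 rho : nat -> 'M[C]_N.+1) :
  (forall x, size (Q x) = x.+1) -> (forall n, M1 n \in unitmx) ->
  (forall n x : nat, (P n).[x%:R] = M1 n * lhorner (Q x) (rho n) * M2 x) ->
  block_vandermonde rho.
Proof.
move=> sQ M1u dual x; exists (fun i => i : nat).
apply: block_vandermonde_unit => A A0.
have AQ0 j : (j < x.+1)%N -> \sum_(i < x.+1) A i * lhorner (Q j) (rho i) = 0.
  move=> le_jx; rewrite /lhorner sQ.
  under eq_bigr do rewrite mulr_sumr; rewrite exchange_big big1 //= => k _.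
  under eq_bigr do rewrite mulrA; rewrite -mulr_suml.
  by rewrite (A0 (widen_ord le_jx k)) mul0r.
pose B (i : nat) : 'M[C]_N.+1 := A (inord i) * (M1 i)^-1.
have BP0 : \sum_(i < x.+1) (B i)%:P * P i = 0.
  apply: (@polymx_eq0 _ _ _ (iota 0 x.+1)) => [||j].
  - exact: iota_uniq.
  - rewrite size_iota (leq_trans (size_sum _ _ _)) //; apply/bigmax_leqP => i _.
    apply/leq_sizeP => k le_k; rewrite coefCM nth_default ?mulr0 //.
    by rewrite (Pmonic i).2 (leq_trans _ le_k).
  rewrite mem_iota => /andP[_ le_jx]; rewrite horner_sum.
  under eq_bigr => i _ do
    rewrite hornerCM dual /B inord_val -!mulrA mulKr ?M1u // mulrA.
  by rewrite -mulr_suml AQ0 ?mul0r.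
move=> i; have := monic_seq_free BP0 (ltn_ord i); rewrite /B inord_val => B0.
by rewrite -[A i](divrK (M1u i)) B0 mul0r.
Qed.

End DualSystems.

(** * From a dual family to an operator *)

Section DualToOperator.
Variables (C : numFieldType) (N : nat) (P : nat -> {poly 'M[C]_N.+1}).
Hypothesis Pmonic : forall n, P n \is monic /\ size (P n) = n.+1.

Lemma eigen_recurrence_nat (D : diffop C N) n G (x : nat) :
  in_BR P D -> second_order D -> is_eigen (P n) D G ->
  (P n).[x.+1%:R] * evalmx (D 1) x%:R + (P n).[x%:R] * evalmx (D 0) x%:R
    + (P n).[x%:R - 1] * evalmx (D (-1)) x%:R = G * (P n).[x%:R].
Proof.
move=> DBR D2 DG; have := eigen_recurrence Pmonic x%:R DBR D2 DG.
by rewrite raddfD raddfB /= -!natr_scalar_mx -natr1.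
Qed.

Lemma associated_unique (D E : diffop C N) (M1 rho : nat -> 'M[C]_N.+1) :
  in_BR2 P D -> in_BR2 P E -> associated P D M1 rho -> associated P E M1 rho ->
  D = E.
Proof.
move=> [[DBR D2] _ _ _] [[EBR E2] _ _ _] DM EM.
apply: (second_order_act_inj Pmonic) => // n.
by rewrite (psi_invP Pmonic n DBR) (psi_invP Pmonic n EBR) DM EM.
Qed.

(** Let w1, w0, wm be the coefficients of P_n(x+1), P_n(x), P_n(x-1) in the
    recurrence written in terms of P_n. Taking n = 0 gives w1 + w0 + wm = G 0,
    and n = 1 then gives w1 - wm = G 1 P_1 - P_1 G 0 (the K of the proof), so
    the rationality of w1 carries over to w0 and wm. At x = 0 the operator and
    the recurrence share w1, and comparing them shows that
    P_n(0)^-1 P_n(-1) F_(-1)(0) is w0(0) - F_0(0). *)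
Lemma dual_family_operator (Q : nat -> {poly 'M[C]_N.+1})
    (M1 M2 rho : nat -> 'M[C]_N.+1) :
  dual_family P Q M1 M2 rho ->
  exists D : diffop C N, in_BR2 P D /\ associated P D M1 rho.
Proof.
move=> [[[Qmonic Q0] [Y [Z [Z0 tt]]] [M1u M2u] [F1 F1v] [dual [M10 M20]]] rhoV].
pose G n := M1 n * rho n * (M1 n)^-1.
pose w1 x := (M2 x.+1)^-1 * M2 x.
pose w0 x := (M2 x)^-1 * Y x * M2 x.
(* [wm x] belongs to the recurrence at x + 1, since there is none at 0. *)
pose wm x := (M2 x)^-1 * Z x.+1 * M2 x.+1.
have P_M1 n : (P n).[0] = M1 n.
  by rewrite -[0]/(0%:R) dual Q0 lhorner1 M20 !mulr1.
have GP n x : G n * (P n).[x%:R] = M1 n * (rho n * lhorner (Q x) (rho n)) * M2 x.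
  by rewrite dual /G -!mulrA mulKr ?M1u.
have rec n y : (P n).[y.+2%:R] * w1 y.+1 + (P n).[y.+1%:R] * w0 y.+1
    + (P n).[y%:R] * wm y = G n * (P n).[y.+1%:R].
  rewrite GP tt !dual /w1 /w0 /wm !mulrDr !mulrDl -!mulrA.
  by rewrite !mulVKr ?M2u.
have rec0 n : (P n).[1%:R] * w1 0%N + (P n).[0] * w0 0%N = G n * (P n).[0].
  rewrite -[0]/(0%:R) GP tt !dual /w1 /w0 mul0r addr0 !mulrDr !mulrDl -!mulrA.
  by rewrite !mulVKr ?M2u.
have P0E (a : 'M[C]_N.+1) : (P 0).[a] = 1 by rewrite monic_seq0 // hornerC.
have P1E (y : nat) : (P 1).[y.+1%:R] = (P 1).[y%:R] + 1.
  by rewrite !natr_scalar_mx !horner_monic1 // -natr1 raddfD /= addrA.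
pose K := constmx (G 1) * shiftmx 0 (P 1) - shiftmx 0 (P 1) * constmx (G 0).
have F1w x : mx_has_value F1 x%:R (w1 x) by move=> i j; apply: F1v.
have shift0v n (x : nat) : mx_has_value (shiftmx 0 (P n)) x%:R (P n).[x%:R].
  have := mx_has_value_shift (P n) 0 (x%:R : C).
  by rewrite mulr0z addr0 -natr_scalar_mx.
have G0E y : G 0%N = w1 y.+1 + w0 y.+1 + wm y.
  by have := rec 0%N y; rewrite !P0E mulr1 !mul1r.
have Kw y : mx_has_value K y.+1%:R (w1 y.+1 - wm y).
  have -> : w1 y.+1 - wm y = G 1 * (P 1).[y.+1%:R] - (P 1).[y.+1%:R] * G 0.
    have P1D : (P 1).[y%:R] = (P 1).[y.+1%:R] - 1 by rewrite P1E addrK.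
    by rewrite -rec (G0E y) (P1E y.+1) P1D elimination_first.
  apply: mx_has_valueB; apply: mx_has_valueM; rewrite ?shift0v //;
    exact: mx_has_value_const.
have Fmw y : mx_has_value (F1 - K) y.+1%:R (wm y).
  by rewrite -[wm y](subKr (w1 y.+1)); apply: mx_has_valueB.
have F0w y : mx_has_value (constmx (G 0) - F1 - (F1 - K)) y.+1%:R (w0 y.+1).
  have -> : w0 y.+1 = G 0 - w1 y.+1 - wm y.
    by rewrite (G0E y) [RHS]addrAC addrK addrAC subrr add0r.
  apply: mx_has_valueB => //; apply: mx_has_valueB => //.
  exact: mx_has_value_const.
have [D [D2 D1E D0E DmE]] :=
  second_order_exists F1 (constmx (G 0) - F1 - (F1 - K)) (F1 - K).
have DG n : is_eigen (P n) D (G n).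
  apply: (@mx_has_value_eq _ _ _ _ (fun y => G n * (P n).[y.+1%:R])) => y.
    have D1v : mx_has_value (D 1) y.+1%:R (w1 y.+1) by rewrite D1E.
    have D0v : mx_has_value (D 0) y.+1%:R (w0 y.+1) by rewrite D0E.
    have Dmv : mx_has_value (D (-1)) y.+1%:R (wm y) by rewrite DmE.
    have := mx_has_value_act (P n) D2 D1v D0v Dmv.
    have -> : y.+1%:R - 1 = y%:R :> C by rewrite -natr1 addrK.
    by rewrite natr1 -!natr_scalar_mx rec.
  by apply: mx_has_valueM; [exact: mx_has_value_const | exact: shift0v].
have DBR : in_BR P D by exists G.
have Dpsi n : psi_inv P D n = G n by apply: psi_invE.
have D1w x : evalmx (D 1) x%:R = w1 x by rewrite D1E; apply: evalmxE.
exists D; split; last exact: Dpsi.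
split; first by split.
- exists (w0 0%N - evalmx (D 0) 0) => n.
  have := eigen_recurrence_nat 0 DBR D2 (DG n).
  rewrite D1w !mulr0n -rec0 -addrA => /addrI; rewrite sub0r -mulrA => /eqP.
  rewrite addrC eq_sym -subr_eq eq_sym => /eqP ->.
  by rewrite -mulrBr mulKr // P_M1 M1u.
- move=> x; rewrite D1w /w1 -[_ \in _]/(_ \is a GRing.unit).
  by rewrite unitrMr ?unitrV; [exact: M2u | exact: M2u].
- exists M1; split=> //; rewrite (_ : (fun n => _) = rho) //.
  by apply/funext => n; rewrite Dpsi /G !mulrA mulVr ?M1u // mul1r divrK ?M1u.
Qed.

End DualToOperator.

(** * From an operator to its dual polynomials *)

Section OperatorToDual.
Variables (C : numFieldType) (N : nat) (P : nat -> {poly 'M[C]_N.+1}).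
Hypothesis Pmonic : forall n, P n \is monic /\ size (P n) = n.+1.
Hypothesis P0unit : forall n, (P n).[0] \in unitmx.

(** The pair (Q_x, Q_(x-1)), with Q_(-1) = 0: the recurrence has two steps. *)
Fixpoint dual_pair (Y Z : nat -> 'M[C]_N.+1) (x : nat) :
    {poly 'M[C]_N.+1} * {poly 'M[C]_N.+1} :=
  if x is y.+1 then
    let q := dual_pair Y Z y in
    (q.1 * 'X - q.1 * (Y y)%:P - q.2 * (Z y)%:P, q.1)
  else (1, 0).

Definition dual_poly Y Z x := (dual_pair Y Z x).1.

Lemma dual_poly_monic Y Z x :
  dual_poly Y Z x \is monic /\ size (dual_poly Y Z x) = x.+1.
Proof.
suff [] : (dual_poly Y Z x \is monic /\ size (dual_poly Y Z x) = x.+1) /\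
          (size (dual_pair Y Z x).2 <= x.+1)%N by [].
rewrite /dual_poly; elim: x => [|x [[qm sq] sq2]] /=.
  by rewrite monic1 size_poly1 size_poly0.
set q := (dual_pair Y Z x).1 in qm sq *; set q2 := (dual_pair Y Z x).2 in sq2 *.
have sMC (r : {poly 'M[C]_N.+1}) c : (size (r * c%:P)%R <= size r)%N.
  by apply/leq_sizeP => k le_rk; rewrite coefMC nth_default // mul0r.
have sX : size (q * 'X) = x.+2 by rewrite size_mulX ?sq // monic_neq0.
have small : (size (- (q * (Y x)%:P) - q2 * (Z x)%:P)%R < size (q * 'X)%R)%N.
  rewrite sX ltnS (leq_trans (size_polyD _ _)) // !size_polyN geq_max.
  by rewrite -{1}sq sMC (leq_trans (sMC _ _)).
rewrite -addrA size_polyDl // sX sq leqnSn; split=> //; split=> //.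
by rewrite monicE lead_coefDl // lead_coefMX -monicE.
Qed.

Lemma dual_poly_three_term Y Z rho : three_term (dual_poly Y Z) rho Y Z.
Proof.
move=> x n; rewrite /dual_poly /= !lhornerB lhornerMX !lhornerMC.
have -> : lhorner (dual_pair Y Z x).2 (rho n) =
    if x is y.+1 then lhorner (dual_pair Y Z y).1 (rho n) else 0.
  by case: x => //=; rewrite /lhorner size_poly0 big_ord0.
by rewrite [X in X + _]addrAC addrNK addrNK.
Qed.

(** The block Vandermonde condition makes a polynomial zero as soon as it
    vanishes at all the rho(n), so the values P_n(x) determine Q_x up to a
    right factor, which is 1 because both candidates are monic. *)
Lemma dual_polys_unique (Q Q' : nat -> {poly 'M[C]_N.+1})
    (M1 M2 M2' rho : nat -> 'M[C]_N.+1) :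
  (forall x, Q x \is monic /\ size (Q x) = x.+1) ->
  (forall x, Q' x \is monic /\ size (Q' x) = x.+1) ->
  (forall n, M1 n \in unitmx) -> (forall x, M2' x \in unitmx) ->
  (forall n x : nat, (P n).[x%:R] = M1 n * lhorner (Q x) (rho n) * M2 x) ->
  (forall n x : nat, (P n).[x%:R] = M1 n * lhorner (Q' x) (rho n) * M2' x) ->
  block_vandermonde rho -> Q' = Q.
Proof.
move=> Qm Qm' M1u M2u' dual dual' V; apply/funext => x.
pose c := M2 x * (M2' x)^-1.
have QcQ : Q' x - Q x * c%:P = 0.
  apply: block_vandermonde_lhorner_eq0 V _ => n; rewrite lhornerB lhornerMC.
  have : M1 n * lhorner (Q x) (rho n) * M2 x = M1 n * lhorner (Q' x) (rho n) * M2' x.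
    by rewrite -dual -dual'.
  rewrite -!mulrA => /(congr1 (fun A => (M1 n)^-1 * A)).
  rewrite !mulKr ?M1u // /c mulrA => ->.
  by rewrite mulrK ?M2u' // subrr.
have c1 : c = 1.
  have := congr1 (fun p : {poly _} => p`_x) QcQ.
  rewrite coefB coefMC coef0 (coef_monic_seq Qm) (coef_monic_seq Qm') mul1r.
  by move/eqP; rewrite subr_eq0 => /eqP.
by move/eqP: QcQ; rewrite c1 mulr1 subr_eq0 => /eqP.
Qed.

Variable D : diffop C N.
Hypothesis DBR2 : in_BR2 P D.

Let U := Upsilon D.
Let F0 (x : nat) := evalmx (D 0) x%:R.
Let Fm1 (x : nat) := evalmx (D (-1)) x%:R.
Let rho n := (P n).[0]^-1 * psi_inv P D n * (P n).[0].

Lemma UpsilonS x : U x.+1 = U x * (evalmx (D 1) x%:R)^-1.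
Proof. by rewrite /U /Upsilon big_ord_recr. Qed.

Lemma Upsilon0 : U 0 = 1.
Proof. by rewrite /U /Upsilon big_ord0. Qed.

Lemma Upsilon_unit x : U x \is a GRing.unit.
Proof.
have [_ _ F1u _] := DBR2; elim: x => [|x IH]; first by rewrite Upsilon0 unitr1.
by rewrite UpsilonS unitrMr // unitrV; apply: F1u.
Qed.

(** Any n may replace 0 in the value at 0, by the independence of n required of
    D. *)
Definition recY x :=
  if x is 0 then F0 0 + (P 0).[0]^-1 * (P 0).[-1] * Fm1 0
  else U x * F0 x * (U x)^-1.

Definition recZ x :=
  if x is y.+1 then U y * Fm1 x * (U x)^-1 else 0.

Lemma recY0E n : recY 0 = F0 0 + (P n).[0]^-1 * (P n).[-1] * Fm1 0.
Proof. by have [_ [c cE] _ _] := DBR2; rewrite /= /Fm1 mulr0n !cE. Qed.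

(** The eigenvalue equation at x, divided by P_n(0) on the left, is the three
    term recurrence for Q_x; at x = 0 the term in P_n(-1), which has no
    counterpart among the Q_x, is absorbed by the first coefficient, and this
    needs it to be independent of n. *)
Lemma dual_poly_values n x :
  (P n).[x%:R] = (P n).[0] * lhorner (dual_poly recY recZ x) (rho n) * U x.
Proof.
have [[DBR D2] _ F1u _] := DBR2.
have DG := psi_invP Pmonic n DBR.
pose q x := lhorner (dual_poly recY recZ x) (rho n).
pose holds x := (P n).[x%:R] = (P n).[0] * q x * U x.
suff : holds x /\ (if x is y.+1 then holds y else True) by case.
elim: x => [|x [hx hprev]].
  by split=> //; rewrite /holds /q /dual_poly /= lhorner1 Upsilon0 !mulr1.
split=> //; rewrite /holds.
(* The two lower terms of the recurrence; only here does x = 0 differ. *)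
have lower : (P n).[0] * (q x * recY x + (if x is y.+1 then q y else 0) * recZ x)
    * U x = (P n).[x%:R] * F0 x + (P n).[x%:R - 1] * Fm1 x.
  case: x hx hprev => [|x] hx hprev.
    rewrite (recY0E n) mul0r addr0 /q /dual_poly /= lhorner1 mul1r Upsilon0 mulr1.
    by rewrite -[0%:R]/0 sub0r mulrDr -mulrA mulVKr // P0unit.
  rewrite hx -natr1 addrK hprev /= mulrDr mulrDl !mulrA.
  by rewrite !divrK ?Upsilon_unit.
have := eigen_recurrence_nat Pmonic x DBR D2 DG.
rewrite -/(F0 x) -/(Fm1 x) -addrA -lower => /(canRL (addrK _)) eF1.
rewrite UpsilonS mulrA; apply: (mulIr (F1u x)).
rewrite divrK ?F1u // eF1 hx.
have -> : psi_inv P D n * ((P n).[0] * q x * U x) = (P n).[0] * (rho n * q x) * U x.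
  by rewrite /rho !mulrA mulrV ?P0unit // mul1r.
rewrite /q dual_poly_three_term -mulrBl -mulrBr; congr (_ * _ * _).
by rewrite -[X in X - _]addrA addrK.
Qed.

Lemma operator_dual_system :
  dual_system P (dual_poly recY recZ) (fun n => (P n).[0]) U rho.
Proof.
have [[DBR D2] _ F1u _] := DBR2.
split.
- by split=> //; apply: dual_poly_monic.
- by exists recY, recZ; split=> //; apply: dual_poly_three_term.
- by split=> // x; apply: Upsilon_unit.
- exists (D 1) => x; have [r1 _ _] := in_BR_regular Pmonic (x%:R : C) DBR D2.
  have F1x : evalmx (D 1) x%:R \is a GRing.unit by apply: F1u.
  by rewrite UpsilonS invrM ?unitrV ?Upsilon_unit // invrK divrK ?Upsilon_unit.
- split; first exact: dual_poly_values.
  by rewrite monic_seq0 // hornerC Upsilon0.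
Qed.

Lemma operator_block_vandermonde : block_vandermonde rho.
Proof.
apply: (dual_block_vandermonde Pmonic _ P0unit dual_poly_values) => x.
exact: (dual_poly_monic _ _ _).2.
Qed.

Lemma operator_dual_unique (Q' : nat -> {poly 'M[C]_N.+1})
    (M1' M2' rho' : nat -> 'M[C]_N.+1) :
  dual_system P Q' M1' M2' rho' -> associated P D M1' rho' ->
  Q' = dual_poly recY recZ.
Proof.
move=> [[Qm' Q0'] _ [M1u' M2u'] _ [dual' [_ M20']]] DM'.
(* At x = 0 the factorization forces M1'(n) = P_n(0), hence rho' = rho. *)
have P0E n : (P n).[0] = M1' n.
  by rewrite -[0]/(0%:R) dual' Q0' lhorner1 M20' !mulr1.
have rhoE n : rho' n = rho n.
  by rewrite /rho DM' !P0E !mulrA mulVr ?M1u' // mul1r divrK ?M1u'.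
have dualU n x :
    (P n).[x%:R] = (P n).[0] * lhorner (Q' x) (rho n) * M2' x.
  by rewrite dual' rhoE P0E.
exact: dual_polys_unique (dual_poly_monic _ _) Qm' P0unit M2u' dual_poly_values
  dualU operator_block_vandermonde.
Qed.

End OperatorToDual.

(** * The correspondence *)

Local Open Scope complex_scope.

Theorem theorem3p9 (R : realType) (N : nat) (W : int -> 'M[R[i]]_N.+1)
    (P : nat -> {poly 'M[R[i]]_N.+1})
    (hW : is_weight W) (hP : is_monic_mvop W P) :
  (forall (Q : nat -> {poly 'M[R[i]]_N.+1}) (M1 M2 rho : nat -> 'M[R[i]]_N.+1),
     dual_family P Q M1 M2 rho ->
     exists! D : diffop R[i] N, in_BR2 P D /\ associated P D M1 rho)
  /\
  (forall D : diffop R[i] N, in_BR2 P D ->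
     let M1 := fun n : nat => (P n).[0] in
     let rho := fun n : nat => (P n).[0]^-1 * psi_inv P D n * (P n).[0] in
     let U := Upsilon D in
     let F0 := fun x : nat => evalmx (D 0) x%:R in
     let Fm1 := fun x : nat => evalmx (D (-1)) x%:R in
     exists Q : nat -> {poly 'M[R[i]]_N.+1},
       [/\ dual_system P Q M1 U rho,
           block_vandermonde rho,
           forall Q' M1' M2' rho', dual_system P Q' M1' M2' rho' ->
             associated P D M1' rho' -> Q' = Q
         & exists Y Z : nat -> 'M[R[i]]_N.+1,
           [/\ three_term Q rho Y Z,
               forall x : nat, (0 < x)%N -> Y x = U x * F0 x * (U x)^-1,
               forall x : nat, (0 < x)%N -> Z x = U x.-1 * Fm1 x * (U x)^-1,
               forall n : nat, Y 0%N = F0 0%N + (P n).[0]^-1 * (P n).[-1] * Fm1 0%N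
             & Z 0%N = 0]]).
Proof.
have [Pmonic _] := hP; split=> [Q M1 M2 rho dual | D DBR2 M1 rho U F0 Fm1].
  have [D [DBR2 DM]] := dual_family_operator Pmonic dual.
  by exists D; split=> // E [EBR2 EM]; apply: (associated_unique Pmonic DBR2 EBR2 DM EM).
have P0unit := mvop_horner0_unit hW hP.
exists (dual_poly (recY P D) (recZ D)); split.
- exact: (operator_dual_system Pmonic P0unit DBR2).
- exact: (operator_block_vandermonde Pmonic P0unit DBR2).
- exact: (operator_dual_unique Pmonic P0unit DBR2).
exists (recY P D), (recZ D); split.
- exact: dual_poly_three_term.
- by case.
- by case.
- exact: (recY0E DBR2).
- by [].
Qed.
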